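(* Let $X\in\mathcal{X}\subseteq\mathbb{R}$ and $Y\in\mathcal{Y}\subseteq\mathbb{R}$ be random variables such that the conditional pdf of $Y$ given $X$ has the univariate exponential family form $$f_{Y|X}(y|x) = h(y)\, e^{x T(y) - \phi(x)}, \qquad y\in\mathcal{Y},\ x\in\mathcal{X},$$ with marginal pdf $f_Y$ of $Y$, and assume the regularity conditions (R) listed in the context. For $\ell\in\mathbb{N}$ let $D_y^{(\ell)}$ be the $\ell$-fold composition of the operator $\frac{1}{T'(y)}\frac{\mathrm{d}}{\mathrm{d}y}$. Then, for every $\ell\in\mathbb{N}$ and every $y\in\mathcal{Y}$ with $T'(y)\neq0$, $$\mathbb{E}[X^{\ell+1}|Y=y] = \frac{h(y)}{f_Y(y)}\, D_y^{(\ell+1)}\, \frac{f_Y(y)}{h(y)}.$$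
   Context: Exponential family: $T:\mathcal{Y}\to\mathbb{R}$ is the sufficient statistic, $\phi:\mathcal{X}\to\mathbb{R}$ the log-partition function, $h:\mathcal{Y}\to[0,\infty)$ the base measure. Standing assumptions: $\mathcal{Y}$ is open, $h$ is absolutely continuous with respect to Lebesgue measure, and $T$ is analytic, with $T'$ having only isolated zeros (the operator $D_y^{(\ell)}$ is not defined at those zeros). It is implicit that $h$ and $f_Y$ are positive on $\mathcal{Y}$, so that $f_Y/h$ and its logarithm are defined. Regularity conditions (R): for every integer $\ell\ge1$ and $U=X^\ell$: $\mathbb{E}[|U| \mid Y=y]<\infty$, $\mathbb{E}[|U|\,|X| \mid Y=y]<\infty$ and $\mathbb{E}[|X| \mid Y=y]<\infty$ for all $y\in\mathcal{Y}$; and $y\mapsto x^\ell\,\iota_{P_{X,Y}}(x;y)$ and $y\mapsto f_{Y|X}(y|x)$ are absolutely continuous for every $x$. Here $\iota_{P_{X,Y}}(x;y) = \log\frac{f_{Y|X}(y|x)}{f_Y(y)}$ is the information density. *)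

(* Defs.v *)
From HB Require Import structures.
From mathcomp Require Import all_boot all_order all_algebra.
From mathcomp Require Import all_classical all_reals all_analysis.
From mathcomp Require Import measurable_realfun.
Set Implicit Arguments.
Unset Strict Implicit.
Unset Printing Implicit Defensive.
Import Order.TTheory GRing.Theory Num.Theory.
Import numFieldNormedType.Exports.
Local Open Scope classical_set_scope.
Local Open Scope ring_scope.

Definition analytic_on (R : realType) (D : set R) (T : R -> R) : Prop :=
  forall y0, D y0 -> exists (a : nat -> R) (r : R), 0 < r /\
    forall y, `|y - y0| < r -> pseries a (y - y0) @ \oo --> T y.

Definition isolated_zeros_on (R : realType) (D : set R) (g : R -> R) : Prop :=
  forall y0, D y0 -> g y0 = 0 -> \forall y \near y0^', g y != 0.

Definition abs_continuous_itv (R : realType) (a b : R) (g : R -> R) : Prop :=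
  forall e : R, 0 < e -> exists2 d : R, 0 < d &
    forall (n : nat) (u v : 'I_n -> R),
      (forall i, a <= u i /\ u i <= v i /\ v i <= b) ->
      trivIset setT (fun i => `]u i, v i[%classic) ->
      \sum_(i < n) (v i - u i) < d ->
      \sum_(i < n) `|g (v i) - g (u i)| < e.

(* On a set that need not be an interval, nor bounded, absolute continuity is
   the local notion: it is required on every compact interval inside the set. *)
Definition abs_continuous_on (R : realType) (D : set R) (g : R -> R) : Prop :=
  forall a b : R, a <= b -> `[a, b]%classic `<=` D -> abs_continuous_itv a b g.

(* In what follows [f y x] stands for f_{Y|X}(y|x). *)
Definition conditional_pdf (R : realType) (d : measure_display)
    (Om : measurableType d) (P : probability Om R) (X Y : {RV P >-> R})
    (calX calY : set R) (f : R -> R -> R) : Prop :=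
  [/\ measurable_fun (calX `*` calY) (fun z : R * R => f z.2 z.1),
      (forall x y, calX x -> calY y -> 0 <= f y x),
      (forall x, calX x ->
        (\int[lebesgue_measure]_(y in calY) (f y x)%:E = 1)%E)
    & forall A B : set R, measurable A -> measurable B ->
        P (X @^-1` A `&` Y @^-1` B) =
        (\int[distribution P X]_(x in A `&` calX)
          \int[lebesgue_measure]_(y in B `&` calY) (f y x)%:E)%E ].

(* The pointwise version of the density of Y obtained by integrating out X;
   the equation forces the integral to be finite. *)
Definition marginal_pdf (R : realType) (d : measure_display)
    (Om : measurableType d) (P : probability Om R) (X : {RV P >-> R})
    (calX calY : set R) (f : R -> R -> R) (fY : R -> R) : Prop :=
  forall y, calY y ->
    (fY y)%:E = (\int[distribution P X]_(x in calX) (f y x)%:E)%E.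

(* E[g(X) | Y = y] for every single y: the integral of g against the
   conditional law of X given Y = y, which by Bayes' rule has density
   f_{Y|X}(y|x) / f_Y(y) with respect to the law of X (see
   [conditional_expectation_indic] and
   [marginal_pdf_density] below). *)
Definition conditional_expectation (R : realType) (d : measure_display)
    (Om : measurableType d) (P : probability Om R) (X : {RV P >-> R})
    (calX : set R) (f : R -> R -> R) (fY : R -> R) (g : R -> R) (y : R)
    : \bar R :=
  (\int[distribution P X]_(x in calX) (g x * (f y x / fY y))%:E)%E.

Definition information_density (R : realType) (f : R -> R -> R) (fY : R -> R)
    (x y : R) : R := ln (f y x / fY y).

Definition exp_family_pdf (R : realType) (h T phi : R -> R) (y x : R) : R :=
  h y * expR (x * T y - phi x).

Definition base_measure (R : realType) (calY : set R) (h : R -> R)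
    (B : set R) : \bar R :=
  (\int[lebesgue_measure]_(y in B `&` calY) (h y)%:E)%E.

Definition log_partition (R : realType) (calX calY : set R) (h T phi : R -> R)
    : Prop :=
  forall x, calX x -> (phi x)%:E =
    lne (\int[lebesgue_measure]_(y in calY) (h y * expR (x * T y))%:E)%E.

Definition regularity (R : realType) (d : measure_display)
    (Om : measurableType d) (P : probability Om R) (X : {RV P >-> R})
    (calX calY : set R) (f : R -> R -> R) (fY : R -> R) : Prop :=
  let condE := conditional_expectation X calX f fY in
  forall l : nat, (1 <= l)%N ->
  [/\ forall y, calY y -> (condE (fun x => `|x ^+ l|)%R y < +oo)%E,
      forall y, calY y -> (condE (fun x => `|x ^+ l| * `|x|)%R y < +oo)%E,
      forall y, calY y -> (condE (fun x => `|x|)%R y < +oo)%E,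
      forall x, calX x ->
        abs_continuous_on calY
          (fun y => x ^+ l * information_density f fY x y)
    & forall x, calX x -> abs_continuous_on calY (fun y => f y x)].

(* Total version of the operator: it is meaningful only near points where T'
   does not vanish and the successive derivatives exist. *)
Definition Dy (R : realType) (T : R -> R) (l : nat) (g : R -> R) : R -> R :=
  iter l (fun (u : R -> R) (y : R) => (derive1 T y)^-1 * derive1 u y) g.

Lemma conditional_expectation_indicE (R : realType) (d : measure_display)
    (Om : measurableType d) (P : probability Om R) (X Y : {RV P >-> R})
    (calX calY : set R) (f : R -> R -> R) (fY : R -> R) (A : set R) (y : R) :
  measurable calX -> measurable calY -> measurable A ->
  conditional_pdf X Y calX calY f -> calY y -> 0 < fY y ->
  (conditional_expectation X calX f fY (\1_A) y * (fY y)%:E =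
   \int[distribution P X]_(x in A `&` calX) (f y x)%:E)%E.
Proof.
move=> mX mY mA [mf f0 _ _] Yy fYy.
have mfy : measurable_fun calX (f y).
  have := @measurable_comp _ _ _ _ _ _ (calX `*` calY)
    (fun z : R * R => f z.2 z.1) calX (fun x => (x, y)).
  apply => //; first exact: measurableX.
    by move=> _ [x Xx <-].
  exact/measurable_funTS/pair2_measurable.
rewrite /conditional_expectation integral_mkcond -ge0_integralZr//; last first.
- by rewrite lee_fin ltW.
- move=> x _; rewrite patchE; case: ifPn => // /set_mem Xx.
  by rewrite lee_fin mulr_ge0// divr_ge0 ?f0// ltW.
- apply/(measurable_restrictT _ mX)/measurable_EFinP.
  apply: measurable_funM; first exact: measurable_funTS.
  exact: measurable_funM.
rewrite [RHS]integral_mkcond; apply: eq_integral => x _.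
rewrite !patchE in_setI andbC.
have [xX|xX] := boolP (x \in calX); last by rewrite mul0e.
rewrite indicE /=; case: (x \in A) => /=; last by rewrite !mul0r mul0e.
by rewrite mul1r -EFinM divfK// gt_eqF.
Qed.

(* Integrated against f_Y, the pointwise conditional law of X given Y
   reproduces the joint law of X and Y. *)
Lemma conditional_expectation_indic (R : realType) (d : measure_display)
    (Om : measurableType d) (P : probability Om R) (X Y : {RV P >-> R})
    (calX calY : set R) (f : R -> R -> R) (fY : R -> R) (A B : set R) :
  measurable calX -> measurable calY -> measurable A -> measurable B ->
  (forall y, calY y -> 0 < fY y) ->
  conditional_pdf X Y calX calY f ->
  (\int[lebesgue_measure]_(y in B `&` calY)
     (conditional_expectation X calX f fY (\1_A) y * (fY y)%:E))%E =
  P (X @^-1` A `&` Y @^-1` B).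
Proof.
move=> mX mY mA mB fY0 cf; have [mf f0 _ ->//] := cf.
set mu := lebesgue_measure; set PX := distribution P X.
pose D := (A `&` calX) `*` (B `&` calY).
have mD : measurable D by apply: measurableX; exact: measurableI.
pose F := ((fun z : R * R => (f z.2 z.1)%:E) \_ D : R * R -> \bar R).
have mF : measurable_fun setT F.
  apply/(measurable_restrictT _ mD)/measurable_EFinP.
  apply: measurable_funS mf; first exact: measurableX.
  by move=> z [[_ ?] [_ ?]].
have F0 z : (0 <= F z)%E.
  rewrite /F patchE; case: ifPn => // /set_mem [[_ ?] [_ ?]].
  by rewrite lee_fin f0.
have FE x y : F (x, y) = if (x \in A `&` calX) && (y \in B `&` calY)
                          then (f y x)%:E else 0%E.
  rewrite /F patchE; congr (if _ then _ else _).
  apply/idP/andP.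
    by move=> /set_mem[? ?]; split; exact/mem_set.
  by move=> [/set_mem ? /set_mem ?]; apply/mem_set.
transitivity (\int[mu]_y \int[PX]_x F (x, y))%E.
  rewrite integral_mkcond; apply: eq_integral => y _.
  rewrite patchE; case: ifPn => yB; last first.
    by rewrite integral0_eq// => x _; rewrite FE (negbTE yB) andbF.
  have Yy : calY y by case/set_mem: yB.
  rewrite (conditional_expectation_indicE mX mY mA cf Yy (fY0 _ Yy)).
  rewrite integral_mkcond; apply: eq_integral => x _.
  by rewrite FE yB andbT patchE.
rewrite -(fubini_tonelli (m1 := PX) (m2 := mu) F)//.
rewrite [RHS]integral_mkcond; apply: eq_integral => x _; rewrite patchE.
case: ifPn => xA; last first.
  by rewrite integral0_eq// => y _; rewrite FE (negbTE xA).
rewrite [RHS]integral_mkcond; apply: eq_integral => y _.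
by rewrite FE xA patchE.
Qed.

(* A function satisfying [marginal_pdf] is a density of Y. *)
Lemma marginal_pdf_density (R : realType) (d : measure_display)
    (Om : measurableType d) (P : probability Om R) (X Y : {RV P >-> R})
    (calX calY : set R) (f : R -> R -> R) (fY : R -> R) (B : set R) :
  measurable calX -> measurable calY -> measurable B ->
  (forall y, calY y -> 0 < fY y) ->
  conditional_pdf X Y calX calY f -> marginal_pdf X calX calY f fY ->
  (\int[lebesgue_measure]_(y in B `&` calY) (fY y)%:E)%E = P (Y @^-1` B).
Proof.
move=> mX mY mB fY0 cf fYE.
rewrite -[in RHS](setTI (Y @^-1` B)) -[setT](preimage_setT X).
rewrite -(conditional_expectation_indic mX mY measurableT mB fY0 cf).
apply: eq_integral => y /set_mem[_ Yy].
rewrite (conditional_expectation_indicE mX mY measurableT cf Yy (fY0 _ Yy)).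
by rewrite setTI fYE.
Qed.

(* Main.v *)
Require Import Defs.
From HB Require Import structures.
From mathcomp Require Import all_boot all_order all_algebra.
From mathcomp Require Import all_classical all_reals all_analysis.
From mathcomp Require Import measurable_realfun.
From mathcomp Require Import ring.
Set Implicit Arguments.
Unset Strict Implicit.
Unset Printing Implicit Defensive.
Import Order.TTheory GRing.Theory Num.Theory.
Import numFieldNormedType.Exports.
Local Open Scope classical_set_scope.
Local Open Scope ring_scope.

(* Writing M_k(t) for the integral of x^k exp(x t - phi(x)) against the law of
   X, one has f_Y / h = M_0 o T and E[X^k | Y = y] = (h / f_Y)(y) M_k(T(y)).
   Under the integral sign M_k' = M_(k+1), so the chain rule turns D_y into the
   shift k -> k+1.  Since T'(y) <> 0, T takes values on both sides of T(y) in
   calY, and |x|^k e^(x t) is dominated by the sum of its values at two such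
   points, where the regularity conditions make it integrable. *)

(** * Termwise differentiation of power series *)

(** Each of the [n.+1] terms of 1 + s + ... + s^n is at least s^n, and the sum is at most
    1/(1-s). *)
Lemma natr_mul_expr_le (R : realType) (s : R) (n : nat) :
  0 <= s -> s < 1 -> n.+1%:R * s ^+ n <= (1 - s)^-1.
Proof.
move=> s0 s1; have s10 : 0 < 1 - s by rewrite subr_gt0.
have sumE : (1 - s) * \sum_(i < n.+1) s ^+ i <= 1.
  rewrite -opprB mulNr -subrX1 opprB gerBl; exact: exprn_ge0.
rewrite -[leRHS]mul1r ler_pdivlMr// mulrC; apply: le_trans sumE.
rewrite ler_pM2l// mulr_natl -[X in _ *+ X]card_ord -sumr_const.
apply: ler_sum => i _; apply: ler_wiXn2l => //; first exact: ltW.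
by have := ltn_ord i; rewrite ltnS.
Qed.

(** Two radii fit between |z| and r: convergence at the outer one, [v], gives absolute convergence
    at [w], and the series at z is compared with that one. The disc is unchanged, so the lemma can
    be iterated. *)
Lemma is_cvg_pseries_diffs (R : realType) (f : nat -> R) (r : R) :
  (forall z, `|z| < r -> cvgn (pseries f z)) ->
  forall z, `|z| < r -> cvgn (pseries (pseries_diffs f) z).
Proof.
move=> cf z zr.
have [v zv vr] : exists2 v, `|z| < v & v < r.
  by exists ((`|z| + r) / 2); rewrite midf_lt.
have [w zw wv] : exists2 w, `|z| < w & w < v.
  by exists ((`|z| + v) / 2); rewrite midf_lt.
have w0 : 0 < w by exact: le_lt_trans zw.
have v0 : 0 < v by exact: lt_trans wv.
(* With s = |z| / w < 1, the factor n+1 is absorbed by (n+1) s^n <= 1/(1-s). *)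
pose s := `|z| / w.
have s0 : 0 <= s by rewrite divr_ge0// ltW.
have s1 : s < 1 by rewrite ltr_pdivrMr// mul1r.
pose g n := `|f n| * w ^+ n.
have cg : cvgn (series g).
  apply: (@is_cvg_pseries_inside_norm _ f v w).
    by apply: cf; rewrite gtr0_norm.
  by rewrite !gtr0_norm.
have cgS : cvgn (series (fun n => g n.+1)).
  have -> : series (fun n => g n.+1) = (fun n => series g n.+1 - g 0%N).
    apply/funext => n; rewrite /series/= [in RHS]big_nat_recl//.
    by rewrite addrC addKr.
  apply: is_cvgB; last exact: is_cvg_cst.
  by move/cvg_ex : cg => [L cL]; apply/cvg_ex; exists L; rewrite cvg_shiftS.
apply: normed_cvg.
have := @is_cvg_seriesZ _ _ ((1 - s)^-1 / w) cgS.
apply: series_le_cvg => [n|n|n] /=.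
- exact: normr_ge0.
- rewrite fctE /g mulr_ge0 ?mulr_ge0 ?exprn_ge0 ?invr_ge0 ?subr_ge0 ?(ltW w0)//.
  exact: ltW.
- rewrite /pseries_diffs !normrM normrX ger0_norm//.
  have -> : `|z| = s * w by rewrite divfK ?gt_eqF.
  have -> : n.+1%:R * `|f n.+1| * (s * w) ^+ n =
            n.+1%:R * s ^+ n * (`|f n.+1| * w ^+ n).
    by rewrite exprMn -!mulrA; congr (_ * _); rewrite mulrCA.
  have -> : (((1 - s)^-1 / w) *: (fun n0 => g n0.+1)) n =
            (1 - s)^-1 * (`|f n.+1| * w ^+ n).
    rewrite fctE /g /GRing.scale/= exprS -!mulrA; congr (_ * _).
    by rewrite mulrCA mulKf ?gt_eqF.
  rewrite ler_wpM2r ?natr_mul_expr_le// mulr_ge0// exprn_ge0// ltW//.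
Qed.

Lemma is_derive_pseries (R : realType) (c : nat -> R) (r x : R) :
  (forall z, `|z| < r -> cvgn (pseries c z)) -> `|x| < r ->
  is_derive x 1 (fun z => limn (pseries c z)) (limn (pseries (pseries_diffs c) x)).
Proof.
move=> cc xr.
(* Termwise differentiation at [x] asks for convergence of the series and of its first two formal
   derivatives at a point [K] farther out; the midpoint of |x| and r serves. *)
have xKr : `|x| < (`|x| + r) / 2 < r by rewrite !midf_lt.
set K := (`|x| + r) / 2 in xKr; have /andP[xK Kr] := xKr.
have K0 : `|K| = K by rewrite ger0_norm// ltW// (le_lt_trans _ xK).
have cK : `|K| < r by rewrite K0.
apply: (@pseries_snd_diffs _ c K); rewrite ?K0//; first exact: cc.
  exact: (is_cvg_pseries_diffs cc).
exact: (is_cvg_pseries_diffs (is_cvg_pseries_diffs cc)).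
Qed.

(** * Local behaviour of T and of the operator D_y *)

Lemma analytic_on_near (R : realType) (D : set R) (T : R -> R) (y : R) :
  analytic_on D T -> D y ->
  (\forall z \near y, derivable T z 1) /\ {for y, continuous (derive1 T)}.
Proof.
move=> + Dy => /(_ _ Dy)[a [r [r0 aT]]].
have cc z : `|z| < r -> cvgn (pseries a z).
  move=> zr; have := aT (y + z); rewrite addrC addKr => /(_ zr).
  by move=> h; apply/cvg_ex; exists (T (y + z)).
have TE z : `|z - y| < r -> T z = limn (pseries a (z - y)).
  by move=> zr; apply/esym/cvg_lim => //; exact: aT.
have near_r z : `|z - y| < r -> \forall u \near z, `|u - y| < r.
  move=> zr.
  have : (fun u => `|u - y|) @ z --> `|z - y|.
    by apply: cvg_norm; apply: cvgB; [exact: cvg_id|exact: cvg_cst].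
  by move=> zl; exact: (cvgr_lt _ zl).
have dshift (F : R -> R) (F' z : R) : is_derive (z - y) 1 F F' ->
    is_derive z 1 (F \o (fun u => u - y)) F'.
  move=> dF; rewrite -[F']mulr1; apply: is_derive1_comp.
  rewrite -[X in is_derive _ _ _ X]subr0.
  exact: (@is_deriveB _ _ _ id (cst y)).
have dT z : `|z - y| < r ->
    is_derive z 1 T (limn (pseries (pseries_diffs a) (z - y))).
  move=> zr; apply: (@near_eq_is_derive _ _ _
      ((fun x => limn (pseries a x)) \o (fun u => u - y))).
    by near=> u; rewrite /= -TE//; near: u; exact: near_r.
  by apply: dshift; exact: is_derive_pseries cc zr.
have yr : `|y - y| < r by rewrite subrr normr0.
split.
  by near=> z; have [] := dT z _ => //; near: z; exact: near_r.
(* On the whole disc T' is the sum of the differentiated series; differentiating once more makes T'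
   derivable, hence continuous, at y. *)
have dT' : is_derive y 1 (derive1 T)
    (limn (pseries (pseries_diffs (pseries_diffs a)) (y - y))).
  apply: (@near_eq_is_derive _ _ _
      ((fun x => limn (pseries (pseries_diffs a) x)) \o (fun u => u - y))).
    near=> u; rewrite /= derive1E.
    have [|_ ->//] := dT u.
    by near: u; exact: near_r.
  by apply: dshift; exact: is_derive_pseries (is_cvg_pseries_diffs cc) yr.
case: dT' => dT' _.
exact/differentiable_continuous/derivable1_diffP.
Unshelve. all: by end_near. Qed.

(** If no point of D had a smaller (or larger) value, y would be a local extremum of T, so T'(y)
    would vanish by Fermat's rule. *)
Lemma derive1_neq0_straddle (R : realType) (T : R -> R) (y : R) (D : set R) :
  open D -> D y -> (\forall z \near y, derivable T z 1) -> derive1 T y != 0 ->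
  exists z1 z2, [/\ D z1, D z2 & T z1 < T y < T z2].
Proof.
move=> oD Dy dT T'y.
have : \forall z \near y, D z /\ derivable T z 1.
  by near=> z; split; near: z => //; exact: open_nbhs_nbhs.
move=> /nbhs_ballP[e /= e0 yeD].
have beE z : z \in `](y - e), (y + e)[ -> D z /\ derivable T z 1.
  by move=> zI; apply: yeD; rewrite ball_itv.
have ee : y - e <= y + e by rewrite lerD2l ge0_cp// ltW.
have yI : y \in `](y - e), (y + e)[.
  by rewrite in_itv/= ltrDl ltrBlDr ltrDl e0.
have [z1 Dz1 Tz1] : exists2 z1, D z1 & T z1 < T y.
  apply: contrapT => /forall2NP hn; move/eqP: T'y; apply.
  rewrite derive1E; have [_ ->//] : is_derive y 1 T 0.
  apply: (derive1_at_min ee _ yI) => t /beE[Dt dt] //.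
  by rewrite leNgt; apply/negP; case: (hn t).
have [z2 Dz2 Tz2] : exists2 z2, D z2 & T y < T z2.
  apply: contrapT => /forall2NP hn; move/eqP: T'y; apply.
  rewrite derive1E; have [_ ->//] : is_derive y 1 T 0.
  apply: (derive1_at_max ee _ yI) => t /beE[Dt dt] //.
  by rewrite leNgt; apply/negP; case: (hn t).
by exists z1, z2; rewrite Tz1 Tz2.
Unshelve. all: by end_near. Qed.

(** Induction on k with the chain rule, each division by T' cancelling the factor it produces. The
    identity is carried on an open set, since differentiating at z requires it in a neighbourhood of
    z. *)
Lemma Dy_comp (R : realType) (T G : R -> R) (M : nat -> R -> R) (U : set R) :
  open U ->
  (forall z, U z -> derivable T z 1 /\ derive1 T z != 0) ->
  (forall k z, U z -> is_derive (T z) 1 (M k) (M k.+1 (T z))) ->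
  (forall z, U z -> G z = M 0%N (T z)) ->
  forall k z, U z -> derivable (Dy T k G) z 1 /\ Dy T k G z = M k (T z).
Proof.
move=> oU dT dM GM.
have step k : (forall z, U z -> Dy T k G z = M k (T z)) ->
    forall z, U z -> is_derive z 1 (Dy T k G) (M k.+1 (T z) * derive1 T z).
  move=> DyM z Uz; apply: (@near_eq_is_derive _ _ _ (M k \o T)).
    by near=> u; rewrite DyM//; near: u; exact: open_nbhs_nbhs.
  have [dTz _] := dT _ Uz; have := dM k _ Uz => ?.
  apply: is_derive1_comp; rewrite derive1E; exact: derivableP.
have DyM k : forall z, U z -> Dy T k G z = M k (T z).
  elim: k => [|k ih] z Uz; first exact: GM.
  have -> : Dy T k.+1 G z = (derive1 T z)^-1 * 'D_1 (Dy T k G) z.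
    by rewrite -derive1E.
  have [_ ->] := step _ ih _ Uz.
  by rewrite mulrC mulfK//; case: (dT _ Uz).
by move=> k z Uz; split; [case: (step _ (DyM k) _ Uz)|exact: DyM].
Unshelve. all: by end_near. Qed.

(** * Moments of an exponentially tilted weight, differentiated under the integral sign *)

Section tilted_moment.
Context d (Om : measurableType d) (R : realType)
  (mu : {measure set Om -> \bar R}) (B : set Om) (X w : Om -> R).

Definition tilted_moment (k : nat) (t : R) : R :=
  (\int[mu]_(x in B) (X x ^+ k * expR (X x * t) * w x))%R.

Hypotheses (mB : measurable B) (mX : measurable_fun B X)
  (mw : measurable_fun B w).
Variables a b : R.

Let intg k t := mu.-integrable B (fun x => (X x ^+ k * expR (X x * t) * w x)%:E).

(* As expR (X x * t) is monotone in t, this dominates the integrand for all t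
   in ]a, b[. *)
Let G k x := `|X x ^+ k * expR (X x * a) * w x| + `|X x ^+ k * expR (X x * b) * w x|.

Let intG k : intg k a -> intg k b -> mu.-integrable B (EFin \o G k).
Proof.
move=> inta intb; rewrite /comp; under eq_fun do rewrite EFinD.
by apply: integrableD => //; apply: integrable_norm; [exact: inta|exact: intb].
Qed.

Let G_ub k t x : a < t < b -> `|X x ^+ k * expR (X x * t) * w x| <= G k x.
Proof.
move=> /andP[a_t t_b]; rewrite /G !normrM -!mulrDl ler_wpM2r// -mulrDr ler_wpM2l//.
rewrite !ger0_norm ?expR_ge0//.
have [x0|x0] := leP 0 (X x).
  by apply: ler_wpDl; rewrite ?expR_ge0// ler_expR ler_wpM2l// ltW.
by apply: ler_wpDr; rewrite ?expR_ge0// ler_expR ler_wnM2l// ltW.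
Qed.

Lemma integrable_tilted_moment k t : a < t < b -> intg k a -> intg k b -> intg k t.
Proof.
move=> t_ab inta intb; apply: le_integrable (intG inta intb) => //.
  apply/measurable_EFinP; apply: measurable_funM => //.
  apply: measurable_funM; first exact: measurable_funX.
  by apply: measurableT_comp => //; exact: measurable_funM.
by move=> x _; rewrite /= lee_fin [leRHS]ger0_norm ?addr_ge0//; exact: G_ub.
Qed.

(** The t-derivative of the integrand of order k is the integrand of order k+1, bounded on all of
    ]a, b[ by the single integrable function [G k.+1]. *)
Lemma is_derive_tilted_moment k t : a < t < b ->
  intg k a -> intg k b -> intg k.+1 a -> intg k.+1 b ->
  is_derive t 1 (tilted_moment k) (tilted_moment k.+1 t).
Proof.
move=> t_ab inta intb intSa intSb.
pose f (s : R) x := X x ^+ k * expR (X x * s) * w x.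
have df s x : is_derive s (1 : R) (fun v : R => f v x)
    (X x ^+ k.+1 * expR (X x * s) * w x).
  rewrite (_ : (fun v : R => f v x) =
      (X x ^+ k * w x) *: (expR \o (X x \*: id))); last first.
    by apply/funext => u; rewrite /f fctE /GRing.scale/= mulrAC.
  rewrite (_ : X x ^+ k.+1 * expR (X x * s) * w x =
      (X x ^+ k * w x) *: (expR (X x * s) * (X x *: 1))); last first.
    by rewrite /GRing.scale/= mulr1 exprSr -!mulrA; congr (_ * _);
      rewrite mulrCA [RHS]mulrC mulrA.
  by apply: is_deriveZ; apply: is_derive1_comp; exact: is_deriveZ.
have d1f s x : partial1of2 f s x = X x ^+ k.+1 * expR (X x * s) * w x.
  by rewrite partial1of2E derive_val.
have tI : [set` `]a, b[] t by rewrite /= in_itv.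
have If s : [set` `]a, b[] s -> mu.-integrable B (EFin \o f s).
  by rewrite /= in_itv/= => sab; exact: integrable_tilted_moment inta intb.
have dfI s x : [set` `]a, b[] s -> B x -> derivable (f ^~ x) s 1.
  by move=> _ _; case: (df s x).
have G0 x : 0 <= G k.+1 x by rewrite addr_ge0.
have ub s x : [set` `]a, b[] s -> B x -> `|partial1of2 f s x| <= G k.+1 x.
  by rewrite /= in_itv/= => sab _; rewrite d1f; exact: G_ub.
have iG := intG intSa intSb.
apply: DeriveDef; first exact: (derivable_under_integral mB tI If dfI G0 iG ub).
rewrite -derive1E (differentiation_under_integral mB tI If dfI G0 iG ub).
by apply: eq_Rintegral => x _; rewrite d1f.
Qed.

End tilted_moment.

(* The first conjunct says that D_y^(l+1) (f_Y / h) is really defined at y,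
   which is not automatic for the total [derive1]. *)
Theorem mainTheorem6 (R : realType) (d : measure_display)
    (Om : measurableType d) (P : probability Om R) (X Y : {RV P >-> R})
    (calX calY : set R) (h T phi fY : R -> R)
    (mcalX : measurable calX) (ocalY : open calY)
    (XcalX : forall w, calX (X w)) (YcalY : forall w, calY (Y w))
    (mh : measurable_fun calY h)
    (h_ac : base_measure calY h `<< @lebesgue_measure R)
    (h_gt0 : forall y, calY y -> 0 < h y)
    (T_analytic : analytic_on calY T)
    (T'_isolated : isolated_zeros_on calY (derive1 T))
    (phiE : log_partition calX calY h T phi)
    (fYX_pdf : conditional_pdf X Y calX calY (exp_family_pdf h T phi))
    (fY_pdf : marginal_pdf X calX calY (exp_family_pdf h T phi) fY)
    (fY_gt0 : forall y, calY y -> 0 < fY y)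
    (reg : regularity X calX calY (exp_family_pdf h T phi) fY)
    (l : nat) (y : R) (ycalY : calY y) (T'y : derive1 T y != 0) :
  (forall k, (k <= l)%N ->
     derivable (Dy T k (fun z => fY z / h z)) y 1) /\
  conditional_expectation X calX (exp_family_pdf h T phi) fY
    (fun x => x ^+ l.+1) y =
  (h y / fY y * Dy T l.+1 (fun z => fY z / h z) y)%:E.
Proof.
set PX := distribution P X; set f := exp_family_pdf h T phi.
pose w (x : R) := expR (- phi x).
pose M := tilted_moment PX calX idfun w.
have fE z x : f z x = h z * (expR (x * T z) * w x).
  by rewrite /f /exp_family_pdf /w -expRD.
have mf z : calY z -> measurable_fun calX (f z).
  move=> zY; have [mf _ _ _] := fYX_pdf.
  have := @measurable_comp _ _ _ _ _ _ (calX `*` calY)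
    (fun v : R * R => f v.2 v.1) calX (fun x => (x, z)).
  apply => //; first exact: measurableX (open_measurable ocalY).
    by move=> _ [x Xx <-].
  exact/measurable_funTS/pair2_measurable.
have mexp z : measurable_fun calX (fun x : R => expR (x * T z)).
  by apply: measurableT_comp => //; exact: measurable_funM.
(* Measurability of exp(-phi) is read off from the conditional density at the fixed y, divided by
   h(y) exp(x T(y)). *)
have mw : measurable_fun calX w.
  have -> : w = (fun x => (h y)^-1 * f y x * expR (x * - T y)).
    apply/funext => x; rewrite fE mulKf ?gt_eqF ?h_gt0// mulrAC -expRD mulrN.
    by rewrite subrr expR0 mul1r.
  apply: measurable_funM; first by apply: measurable_funM => //; exact: mf.
  by apply: measurableT_comp => //; exact: measurable_funM.
have intM k z : calY z ->
    PX.-integrable calX (fun x => (x ^+ k * expR (x * T z) * w x)%:E).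
  move=> zY; have hz := h_gt0 _ zY; have fYz := fY_gt0 _ zY.
  have mX : measurable_fun calX (fun x : R => `|x ^+ k|).
    by apply: measurableT_comp => //; exact: measurable_funX.
  (* The integrand is, in absolute value, a constant [q] times a nonnegative [v] of finite
     integral. *)
  have [q [v [mv v0 intv gv]]] : exists q (v : R -> R),
      [/\ measurable_fun calX v, (forall x, 0 <= v x),
        (\int[PX]_(x in calX) (v x)%:E < +oo)%E
        & forall x, `|x ^+ k * expR (x * T z) * w x| = `|q * v x| ].
    (* The regularity conditions only cover k >= 1; finiteness for k = 0 is
       contained in the existence of the marginal density. *)
    case: k mX => [|k] mX.
      exists (h z)^-1, (f z); split; first exact: mf.
      - by move=> x; rewrite fE /w !mulr_ge0 ?expR_ge0// ltW.
      - by rewrite -fY_pdf// ltry.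
      - by move=> x; rewrite expr0 mul1r fE mulKf// gt_eqF.
    exists (fY z / h z), (fun x => `|x ^+ k.+1| * (f z x / fY z)); split.
    - by apply: measurable_funM => //; apply: measurable_funM => //; exact: mf.
    - by move=> x; rewrite fE /w !mulr_ge0 ?invr_ge0 ?expR_ge0// ltW.
    - by have [+ _ _ _ _] := reg k.+1 isT; exact.
    - move=> x; rewrite fE -!mulrA !normrM normr_id.
      have /gt_eqF hz0 : 0 < `|h z| by rewrite normr_gt0 gt_eqF.
      have /gt_eqF fz0 : 0 < `|fY z| by rewrite normr_gt0 gt_eqF.
      by rewrite !normfV; field; rewrite hz0 fz0.
  have iv : PX.-integrable calX (EFin \o v).
    apply/integrableP; split; first exact/measurable_EFinP.
    by under eq_integral do rewrite /= ger0_norm//.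
  apply: le_integrable (integrableZl mcalX q iv) => //.
    apply/measurable_EFinP; apply: measurable_funM => //.
    by apply: measurable_funM => //; exact: measurable_funX.
  by move=> x _; rewrite /= lee_fin gv.
(* The constant [c] will be h(z) for the marginal density and h(y)/f_Y(y) for the conditional
   moment. *)
have ME k z c : calY z -> (\int[PX]_(x in calX)
    (c * (x ^+ k * expR (x * T z) * w x))%:E = (c * M k (T z))%:E)%E.
  move=> zY; under eq_integral do rewrite EFinM.
  rewrite integralZl ?intM// EFinM /M /tilted_moment /Rintegral fineK//.
  exact: (integrable_fin_num mcalX (intM k z zY)).
have [dT cT'] := analytic_on_near T_analytic ycalY.
have [z1 [z2 [z1Y z2Y z12]]] := derive1_neq0_straddle ocalY ycalY dT T'y.
have cT : {for y, continuous T}.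
  exact/differentiable_continuous/derivable1_diffP/(nbhs_singleton dT).
(* [z1] and [z2] stay fixed while z varies: every z in the interior of [Q] has T(z) in the same
   interval ]T(z1), T(z2)[, at whose ends all moments are integrable. This interior is the open set
   needed for the chain rule. *)
pose Q z := [/\ calY z, derivable T z 1, derive1 T z != 0 & T z1 < T z < T z2].
have nearQ : \forall z \near y, Q z.
  have /andP[Tz1 Tz2] := z12.
  near=> z; split; [|near: z; exact: dT|near: z; exact: cvgr_neq0 cT' T'y|].
    by near: z; exact: open_nbhs_nbhs.
  apply/andP; split; near: z; [exact: (cvgr_gt _ cT)|exact: (cvgr_lt _ cT)].
have yU : (interior Q) y by exact: nearQ.
have UQ z : interior Q z -> Q z by exact: interior_subset.
have Dk := Dy_comp (T := T) (G := fun z => fY z / h z) (M := M)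
  (open_interior Q).
have {}Dk k : derivable (Dy T k (fun z => fY z / h z)) y 1 /\
    Dy T k (fun z => fY z / h z) y = M k (T y).
  apply: Dk yU => [z /UQ[]//|j z /UQ[_ _ _ Tz]|z /UQ[zY _ _ _]].
    apply: is_derive_tilted_moment Tz _ _ _ _ => //; try exact: intM.
    exact: measurable_id.
  have : (fY z)%:E = (h z * M 0%N (T z))%:E.
    rewrite fY_pdf// -ME//; apply: eq_integral => x _.
    by rewrite -/f fE expr0 mul1r.
  by case=> ->; rewrite mulrAC mulfV ?mul1r// gt_eqF// h_gt0.
split=> [k _|]; first by have [] := Dk k.
have [_ ->] := Dk l.+1.
rewrite -ME//; apply: eq_integral => x _.
by rewrite -/f fE; congr EFin; ring.
Unshelve. all: by end_near. Qed.
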